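(* Let $t\ge 2$ be an integer, let $P$ be a set of $n$ points in the plane and let $\mathcal{R}$ be a set of axis-parallel rectangles in the plane. Then $\chi^t_{CF}(H(P,\mathcal{R}))=O(t^2\log^2 n)$, with an absolute implied constant.
   Context: Given two families of sets $\mathcal{B}$ and $\mathcal{C}$, the intersection hypergraph $H(\mathcal{B},\mathcal{C})$ has vertex set $\mathcal{B}$, and each $c\in\mathcal{C}$ defines a hyperedge $\{b\in\mathcal{B}: b\cap c\neq\emptyset\}$ (points are identified with singletons, so $H(P,\mathcal{R})$ has vertex set $P$ and hyperedges $r\cap P$, $r\in\mathcal{R}$). For a hypergraph $(V,\mathcal{E})$ and $t\in\mathbb{N}$, a $t$-subset-CF-colouring with $k$ colours is a function $\varphi$ from the $t$-element subsets of $V$ to a $k$-element set such that every $h\in\mathcal{E}$ with $|h|>t$ contains a $t$-subset $s\subseteq h$ whose colour differs from the colours of all other $t$-subsets of $h$; $\chi^t_{CF}$ is the least such $k$. *)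

(* Defs.v *)
From HB Require Import structures.
From mathcomp Require Import all_boot all_order all_algebra finmap.
From mathcomp Require Import all_classical all_reals all_analysis.

Set Implicit Arguments.
Unset Strict Implicit.
Unset Printing Implicit Defensive.

Import Order.TTheory GRing.Theory Num.Theory.

Local Open Scope fset_scope.
Local Open Scope classical_set_scope.

Record hypergraph (T : choiceType) := Hypergraph {
  vertices : {fset T};
  hyperedges : set {fset T};
  hyperedges_sub : forall h, hyperedges h -> (h `<=` vertices)%fset
}.

Section SubsetCF.
Variables (T : choiceType) (G : hypergraph T) (t : nat).

(* Only the values of [phi] on the t-subsets of the vertex set matter; the
   colour set is {0, ..., k - 1}. Zero colours suffice exactly when there are
   no t-subsets, i.e. when there are fewer than t vertices. *)
Definition subset_CF_colouring (k : nat) (phi : {fset T} -> nat) : Prop :=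
  (forall s, (s `<=` vertices G)%fset -> #|` s| = t -> (phi s < k)%N) /\
  (forall h, hyperedges G h -> (t < #|` h|)%N ->
    exists s, [/\ (s `<=` h)%fset, #|` s| = t &
      forall s', (s' `<=` h)%fset -> #|` s'| = t -> s' <> s ->
        phi s' <> phi s]).

Definition subset_CF_colourable (k : nat) : Prop :=
  exists phi, subset_CF_colouring k phi.

(* Giving all sets of vertices distinct colours is a colouring. *)
Lemma subset_CF_colourable_ex : exists k, `[< subset_CF_colourable k >].
Proof.
pose V := vertices G; pose e := enum_fset (fpowerset V).
exists (size e); apply/asboolP; exists (fun s => index s e); split.
  by move=> s sV _; rewrite index_mem fpowersetE.
move=> h /hyperedges_sub hV th.
have tE : size (take t (enum_fset h)) = t by rewrite size_takel // ltnW.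
pose s := [fset x in take t (enum_fset h)].
have sh : (s `<=` h)%fset by apply/fsubsetP => x; rewrite inE => /mem_take.
exists s; split => //.
  by rewrite card_fseq undup_id ?tE // take_uniq // enum_fset_uniq.
move=> s' s'h _ ne eqi; apply: ne; apply: (index_inj s _ _ eqi);
  by rewrite fpowersetE; apply: fsubset_trans hV.
Qed.

Definition chi_CF : nat := ex_minn subset_CF_colourable_ex.

End SubsetCF.

Section Intersection.
Variable (U : Type).

Definition meeting_members (B : {fset set U}) (c : set U) : {fset set U} :=
  [fset b in B | `[< b `&` c !=set0 >] ]%fset.

Lemma meeting_members_sub (B : {fset set U}) (C : set (set U)) h :
  [set meeting_members B c | c in C] h -> (h `<=` B)%fset.
Proof. by move=> [c _ <-]; apply/fsubsetP => b; rewrite !inE => /andP[]. Qed.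

Definition intersection_hypergraph (B : {fset set U}) (C : set (set U)) :
  hypergraph (set U) := Hypergraph (@meeting_members_sub B C).

End Intersection.

Definition point_singletons (U : choiceType) (P : {fset U}) : {fset set U} :=
  [fset [set p] | p in P]%fset.

(* The four booleans decide which sides belong to the rectangle, so that open,
   closed and half-open rectangles are all covered. *)
Definition axis_parallel_rectangle (R : realType) (r : set (R * R)) : Prop :=
  exists (a b c d : R) (wa wb wc wd : bool), [/\ (a < b)%R, (c < d)%R &
    r = [set` Interval (BSide wa a) (BSide wb b)] `*`
        [set` Interval (BSide wc c) (BSide wd d)]].

(* Main.v *)
(* Replace the coordinates by injective ranks, and let the split height of a set
   be the least j such that a dyadic interval of length 2^j contains its
   second ranks. If a hyperedge h has split height j + 1, the midline of its
   dyadic interval cuts h into two nonempty parts, each of which is a rectangle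
   based on that line ("bottomless"). A t-subset of h meets both parts exactly
   when its split height is also j + 1, so the split height may be used as the
   first component of the colour.

   For the second component, every point gets a weight O(t log n) such that in
   each bottomless rectangle two points of equal weight are outweighed by at
   least t others. Such weights are found by repeatedly peeling off a subset
   whose members are pairwise separated by t points inside any bottomless
   rectangle containing both; the conflict graph is 2t-degenerate, so each step
   removes a 1/(2t + 1) fraction. Colouring a t-subset by its total weight, the
   heaviest t-subset of h meeting both parts is unique by an exchange argument.
   This gives O(log n) * O(t * t log n) colours. *)
Require Import Defs.
From HB Require Import structures.
From mathcomp Require Import all_boot all_order all_algebra finmap.
From mathcomp Require Import all_classical all_reals all_analysis.
From mathcomp Require Import zify ring lra.

Set Implicit Arguments.
Unset Strict Implicit.
Unset Printing Implicit Defensive.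

Import Order.TTheory GRing.Theory Num.Theory.

(** * Weights by repeated peeling of sparse sets *)

Section StrongColouring.
Local Open Scope fset_scope.
Local Open Scope nat_scope.
Variable T : choiceType.

(** Greedy choice: taking [q] of small degree and discarding it with its neighbours costs at most
    [d + 1] vertices per chosen one. *)
Lemma degenerate_independent (r : rel T) (d : nat) (V : {fset T}) :
  symmetric r ->
  (forall U : {fset T}, U `<=` V -> U != fset0 ->
    exists2 q, q \in U & #|` [fset p in U | (p != q) && r q p]| <= d) ->
  exists I : {fset T}, [/\ I `<=` V, #|` V| <= d.+1 * #|` I| &
    {in I &, forall p q, p != q -> ~~ r p q}].
Proof.
move=> r_sym; have [n] := ubnP #|` V|; elim: n V => // n IHn V ltVn dgV.
have [->|V0] := eqVneq V fset0.
  by exists fset0; rewrite cardfs0 fsub0set; split => // p q; rewrite in_fset0.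
have [q qV leNd] := dgV V (fsubset_refl V) V0.
set N := [fset p in V | _] in leNd.
pose W := V `\` (q |` N).
have WV : W `<=` V by apply: fsubsetDl.
have qNV : q |` N `<=` V.
  by rewrite fsubUset fsub1set qV; apply/fsubsetP => p; rewrite !inE => /andP[].
have cardW : #|` V| <= #|` W| + d.+1.
  have := cardfsDS qNV; have := fsubset_leq_card qNV; rewrite -/W.
  have : #|` q |` N| <= d.+1.
    by rewrite cardfsU1 -(add1n d) leq_add //; case: (_ \notin _).
  lia.
have WltV : #|` W| < #|` V|.
  apply: fproper_ltn_card; rewrite fproperEneq WV andbT.
  by apply: contraTneq qV => <-; rewrite !inE eqxx.
have [||I [IW cardI indI]] := IHn W.
- by lia.
- by move=> U UW U0; apply: dgV => //; apply: fsubset_trans WV.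
have qI : q \notin I.
  by apply: contraTN isT => /(fsubsetP IW); rewrite !inE eqxx.
have nrI p : p \in I -> ~~ r q p.
  move=> pI; have := fsubsetP IW p pI; rewrite !inE.
  by case: (p == q) => //=; case: (p \in V) => //=; rewrite andbT.
exists (q |` I); split.
- by rewrite fsubUset fsub1set qV; apply: fsubset_trans WV.
- by rewrite cardfsU1 qI mulnDr muln1; lia.
move=> x y; rewrite !in_fset1U => /orP[/eqP->|xI] /orP[/eqP->|yI].
- by rewrite eqxx.
- by move=> _; apply: nrI.
- by move=> _; rewrite r_sym; apply: nrI.
- exact: indI.
Qed.

(** The class of [p] within the smallest bottomless rectangle spanned by [p] and [q], vertical sides
    excluded: [X] is the position along the base line, [K] the height above it. *)
Definition between (X K g : T -> nat) (V : {fset T}) (p q : T) : {fset T} :=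
  [fset z in V | [&& g z == g p, minn (X p) (X q) < X z,
    X z < maxn (X p) (X q) & K z <= maxn (K p) (K q)]].

(** Two points of one class conflict when fewer than [t] points lie between them. In any subset the
    highest point has at most [t] conflicts on each side. *)
Lemma sparse_set (X K g : T -> nat) (t : nat) (V : {fset T}) :
  {in V &, injective X} ->
  exists I : {fset T}, [/\ I `<=` V, #|` V| <= (t.*2).+1 * #|` I| &
    {in I &, forall p q, p != q -> g p = g q -> t <= #|` between X K g V p q|}].
Proof.
move=> X_inj.
pose r p q := (g p == g q) && (#|` between X K g V p q| < t).
have r_sym : symmetric r.
  move=> p q; rewrite /r eq_sym; case: eqVneq => //= e; congr (#|` _| < _).
  by apply/fsetP => z; rewrite !inE e minnC maxnC [maxn (K _) _]maxnC.
have [||I [IV cardI indI]] := @degenerate_independent r t.*2 V; first by [].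
  move=> U UV /fset0Pn[x xU].
  have [q qU qmax] : exists2 q, q \in U & forall p, p \in U -> K p <= K q.
    have [[q qU] _ qmax] := @arg_maxnP U [` xU] predT (fun y => K (val y)) isT.
    by exists q => // p pU; apply: (qmax [` pU]).
  exists q => //.
  pose NR := [fset p in U | r q p && (X q < X p)].
  pose NL := [fset p in U | r q p && (X p < X q)].
  (* The extreme neighbours on either side have all the others on that side
     between themselves and [q]. *)
  have NRt : #|` NR| <= t.
    have [->|/fset0Pn[y yNR]] := eqVneq NR fset0; first by rewrite cardfs0.
    have [[p pNR] _ pmax] :=
      @arg_maxnP NR [` yNR] predT (fun y => X (val y)) isT.
    have := pNR; rewrite !inE => /and3P[pU /andP[/eqP gqp ltt] Xqp].
    rewrite (cardfsD1 p) pNR add1n; apply: leq_ltn_trans ltt.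
    apply/fsubset_leq_card/fsubsetP => z; rewrite in_fsetD1 => /andP[zp zNR].
    have Xzp := pmax [` zNR] isT; rewrite /= in Xzp.
    move: zNR; rewrite !inE => /and3P[zU /andP[/eqP gqz _] Xqz].
    have zV := fsubsetP UV z zU; have pV := fsubsetP UV p pU.
    have Xne : X z != X p by apply: contra_neq zp; apply: X_inj.
    have := qmax z zU; rewrite zV -gqz eqxx /=; clear -Xzp Xne Xqz; lia.
  have NLt : #|` NL| <= t.
    have [->|/fset0Pn[y yNL]] := eqVneq NL fset0; first by rewrite cardfs0.
    have [[p pNL] _ pmin] :=
      @arg_minnP NL [` yNL] predT (fun y => X (val y)) isT.
    have := pNL; rewrite !inE => /and3P[pU /andP[/eqP gqp ltt] Xqp].
    rewrite (cardfsD1 p) pNL add1n; apply: leq_ltn_trans ltt.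
    apply/fsubset_leq_card/fsubsetP => z; rewrite in_fsetD1 => /andP[zp zNL].
    have Xzp := pmin [` zNL] isT; rewrite /= in Xzp.
    move: zNL; rewrite !inE => /and3P[zU /andP[/eqP gqz _] Xqz].
    have zV := fsubsetP UV z zU; have pV := fsubsetP UV p pU.
    have Xne : X z != X p by apply: contra_neq zp; apply: X_inj.
    have := qmax z zU; rewrite zV -gqz eqxx /=; clear -Xzp Xne Xqz; lia.
  apply: (@leq_trans #|` NL `|` NR|); last first.
    by rewrite cardfsU -addnn; lia.
  apply/fsubset_leq_card/fsubsetP => p; rewrite !inE => /and3P[pU pq rqp].
  have pV := fsubsetP UV p pU; have qV := fsubsetP UV q qU.
  have Xne : X p != X q by apply: contra_neq pq; apply: X_inj.
  by rewrite pU rqp /=; lia.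
exists I; split => // p q pI qI pq gpq; have := indI p q pI qI pq.
by rewrite /r gpq eqxx -leqNgt.
Qed.

(** [f p] is the round in which [p] is peeled off. Each round leaves at most a fraction
    [1 - 1/(2t + 1)] of the points, whence the logarithm. *)
Lemma strong_colouring (R : realType) (X K g : T -> nat) (t : nat)
    (V : {fset T}) :
  {in V &, injective X} ->
  exists f : T -> nat,
    {in V, forall p, ((f p)%:R <= (t.*2).+1%:R * ln (#|` V|%:R) :> R)%R} /\
    {in V &, forall p q, p != q -> g p = g q -> f p = f q ->
      t <= #|` [fset z in between X K g V p q | f p < f z]|}.
Proof.
have [n] := ubnP #|` V|; elim: n V => // n IHn V ltVn X_inj.
have [V0|V0] := eqVneq V fset0.
  by exists (fun=> 0); rewrite V0; split => p; rewrite in_fset0.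
have [I [IV cardI sparseI]] := sparse_set K g t X_inj.
have V_gt0 : 0 < #|` V| by rewrite cardfs_gt0.
have I_gt0 : 0 < #|` I| by case: (#|` I|) cardI V_gt0 => //; lia.
pose W := V `\` I.
have WV : W `<=` V by apply: fsubsetDl.
have cardW : #|` W| = #|` V| - #|` I| by rewrite cardfsDS.
have leIV := fsubset_leq_card IV.
have [||f [f_le f_strong]] := IHn W; first by lia.
  by move=> p q /(fsubsetP WV) pV /(fsubsetP WV) qV; apply: X_inj.
pose f1 p := if p \in I then 0 else (f p).+1.
exists f1; split.
  move=> p pV; rewrite /f1; case: ifPn => [pI|pI].
    by rewrite mulr_ge0 ?ln_ge0 ?ler0n // ler1n.
  have pW : p \in W by rewrite !inE pI.
  have W_gt0 : 0 < #|` W| by rewrite cardfs_gt0; apply/fset0Pn; exists p.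
  rewrite -natr1; apply: (le_trans (lerD (f_le p pW) (lexx 1%R))).
  set s : R := ((t.*2).+1%:R)%R.
  have s_gt0 : (0 < s)%R by rewrite ltr0n.
  set v : R := (#|` V|%:R)%R; set w : R := (#|` W|%:R)%R.
  have v_gt0 : (0 < v)%R by rewrite ltr0n.
  have w_gt0 : (0 < w)%R by rewrite ltr0n.
  have wle : (s * w <= s * v - v)%R.
    rewrite lerBrDr /s /v /w -!natrM -natrD ler_nat cardW; nia.
  have -> : w = (v * (w / v))%R by field; rewrite gt_eqF.
  rewrite lnM ?posrE ?divr_gt0 //.
  (* With [w / v <= 1 - 1/s], this makes [s * ln] of the size drop by at least 1 per round, which
     pays for the successor in [f1]. *)
  have lnle : (ln (w / v) <= w / v - 1)%R.
    rewrite [leLHS](_ : _ = ln (1 + (w / v - 1)))%R; last by congr ln; ring.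
    by apply: le_ln1Dx; rewrite ltrBrDl subrr divr_gt0.
  have : (s * (w / v) <= s - 1)%R.
    by rewrite mulrA ler_pdivrMr // mulrBl mul1r.
  have := ler_wpM2l (ltW s_gt0) lnle.
  by rewrite [(s * (w / v - 1))%R]mulrBr mulr1 mulrDr; lra.
move=> p q pV qV pq gpq; rewrite /f1.
have [pI|pI] := ifPn; have [qI|qI] // := ifPn; last first.
  case=> fpq.
  have pW : p \in W by rewrite !inE pI.
  have qW : q \in W by rewrite !inE qI.
  apply: leq_trans (f_strong p q pW qW pq gpq fpq) _.
  apply/fsubset_leq_card/fsubsetP => z; rewrite !inE => /andP[].
  by case/andP=> /andP[/negbTE zI ->] -> fz; rewrite zI.
(* A member of [I] between [p] and [q] may replace [q], which shrinks the set between. Once none is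
   left, all points between lie outside [I] and have positive weight. *)
move=> _; have [m] := ubnP #|` between X K g V p q|.
elim: m q {qV} pq gpq qI => // m IHm q pq gpq qI ltm.
have [/hasP[z zI zb]|/hasPn none] := boolP (has (mem (between X K g V p q)) I).
  have sub : between X K g V p z `<=` between X K g V p q.
    apply/fsubsetP => y; move: zb; rewrite !inE => /and5P[_ _ z1 z2 z3].
    case/and5P=> -> -> y1 y2 y3 /=; clear -z1 z2 z3 y1 y2 y3; lia.
  have znb : z \notin between X K g V p z by rewrite !inE; clear; lia.
  have ltz : #|` between X K g V p z| < #|` between X K g V p q|.
    apply: fproper_ltn_card; rewrite fproperEneq sub andbT.
    by apply: contraNneq znb => ->.
  have [pz gpz] : p != z /\ g p = g z.
    move: zb; rewrite !inE => /and5P[_ /eqP gz lo hi _]; split => //.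
    by apply/eqP => e; move: lo hi; rewrite -e; clear; lia.
  apply: leq_trans (IHm z pz gpz zI (leq_trans ltz ltm)) _.
  apply/fsubset_leq_card/fsubsetP => y; rewrite !inE => /andP[yb ->].
  by rewrite andbT; move/fsubsetP/(_ y): sub; rewrite !inE => /(_ yb).
apply: leq_trans (sparseI p q pI qI pq gpq) _.
apply/fsubset_leq_card/fsubsetP => z zb; rewrite in_fset inE zb /=.
by case: ifPn => // /none; rewrite /= zb.
Qed.

End StrongColouring.

(** * Uniqueness of the heaviest crossing subset *)

Section HeaviestSubset.
Local Open Scope fset_scope.
Local Open Scope nat_scope.
Variables (T : choiceType) (c : pred T) (w : T -> nat).

Definition crossing (S : {fset T}) : bool := has c S && has (predC c) S.

Lemma crossingP (S : {fset T}) :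
  reflect (forall b, exists2 x, x \in S & c x = b) (crossing S).
Proof.
apply: (iffP andP) => [[/hasP[x xS cx] /hasP[y yS /negbTE cy]] []|cS].
- by exists x.
- by exists y.
have [[x xS cx] [y yS cy]] := (cS true, cS false).
by split; apply/hasP; [exists x|exists y => //=; rewrite cy].
Qed.

(** One point from each side is completed by [t - 2] arbitrary others. *)
Lemma crossing_subset (t : nat) (h : {fset T}) :
  2 <= t <= #|` h| -> crossing h ->
  exists S : {fset T}, [/\ S `<=` h, #|` S| = t & crossing S].
Proof.
move=> /andP[t2 th] /crossingP ch.
have [[x xh cx] [y yh cy]] := (ch true, ch false).
have xy : x != y by apply: contra_eq_neq cx => ->; rewrite cy.
have xyh : [fset x; y] `<=` h by rewrite fsubUset !fsub1set xh yh.
have card_xy : #|` [fset x; y]| = 2 by rewrite cardfs2 xy.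
pose s := take (t - 2) (h `\` [fset x; y]).
have s_size : size s = t - 2.
  by rewrite size_takel // // cardfsDS // card_xy leq_sub2r.
have sP z : z \in s -> z \in h `\` [fset x; y] by move=> /mem_take.
have card_s : #|` [fset z in s]| = t - 2.
  by rewrite card_fseq undup_id // take_uniq // fset_uniq.
exists ([fset x; y] `|` [fset z in s]); split.
- rewrite fsubUset xyh; apply/fsubsetP => z; rewrite inE /= => /sP.
  by rewrite in_fsetD => /andP[].
- rewrite cardfsU card_xy card_s.
  suff -> : [fset x; y] `&` [fset z in s] = fset0 by rewrite cardfs0; lia.
  apply/fsetP => z; rewrite in_fsetI in_fset0; apply/negP => /andP[zxy].
  by rewrite inE /= => /sP; rewrite in_fsetD zxy.
- by apply/crossingP => -[]; [exists x|exists y]; rewrite // !inE eqxx ?orbT.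
Qed.

Lemma card_swap (S : {fset T}) x z :
  x \in S -> z \notin S -> #|` z |` (S `\ x)| = #|` S|.
Proof.
move=> xS zS.
by rewrite cardfsU1 !inE (negbTE zS) andbF [RHS](cardfsD1 x) xS.
Qed.

Lemma sum_swap (S : {fset T}) x z : x \in S -> z \notin S ->
  \sum_(y <- z |` (S `\ x)) w y + w x = \sum_(y <- S) w y + w z.
Proof.
move=> xS zS; rewrite big_fsetU1 ?inE ?(negbTE zS) ?andbF //=.
by rewrite [in RHS](big_fsetD1 x) //=; lia.
Qed.

(** If [S] and [S'] are both heaviest, exchanges within a side show that points of [S \ S'] and
    [S' \ S] lie on opposite sides. Exchanging such a pair in both directions gives equal weights on
    opposite sides, which the hypothesis on [w] forbids. *)
Lemma unique_heaviest (t : nat) (h : {fset T}) :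
  2 <= t <= #|` h| -> crossing h ->
  {in h &, forall p q, p != q -> w p = w q ->
    c p = c q /\ t <= #|` [fset z in h | (c z == c p) && (w p < w z)]|} ->
  exists S : {fset T}, [/\ S `<=` h, #|` S| = t, crossing S &
    forall S' : {fset T}, S' `<=` h -> #|` S'| = t -> crossing S' -> S' != S ->
      \sum_(p <- S') w p <> \sum_(p <- S) w p].
Proof.
move=> t2h ch w_strong.
pose weight (S : {fset T}) := \sum_(p <- S) w p.
pose good (S : {fset T}) := [&& S `<=` h, #|` S| == t & crossing S].
pose heaviest S := good S /\ forall S', good S' -> weight S' <= weight S.
have swap_le S x z : heaviest S -> x \in S -> z \in h -> z \notin S ->
    crossing (z |` (S `\ x)) -> w z <= w x.
  case=> /and3P[Sh /eqP tS _] maxS xS zh zS cS'.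
  have := maxS (z |` (S `\ x)); rewrite /good cS' card_swap // tS eqxx.
  rewrite fsubUset fsub1set zh (fsubset_trans (fsubsetDl _ _) Sh) => /(_ isT).
  by have := sum_swap xS zS; rewrite /weight; lia.
have swap_crossing S x z : heaviest S -> x \in S -> c z = c x ->
    crossing (z |` (S `\ x)).
  case=> /and3P[_ _ /crossingP cS] _ xS cz; apply/crossingP => b.
  have [cxb|cxb] := eqVneq (c x) b; first by exists z; rewrite ?in_fset1U ?eqxx ?cz.
  have [y yS cy] := cS b; exists y => //.
  by rewrite !inE yS andbT; apply/orP; right; apply: contra_neq cxb => <-.
(* Equality is impossible: [z] would then be beaten by [t] points on its side,
   one of which lies outside [S]. *)
have side_lt S x z : heaviest S -> x \in S -> z \in h -> z \notin S ->
    c z = c x -> w z < w x.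
  move=> HS xS zh zS czx; rewrite ltn_neqAle.
  rewrite (swap_le S) ?swap_crossing // andbT; apply/negP => /eqP wzx.
  have [/and3P[Sh /eqP tS /crossingP cS] _] := HS.
  have zx : z != x by apply: contraNneq zS => ->.
  have [_ tz] := w_strong z x zh (fsubsetP Sh x xS) zx wzx.
  have [y yS cy] := cS (~~ c x).
  have [sub|] := boolP ([fset u in h | (c u == c z) && (w z < w u)] `<=` S `\ y).
    have := leq_trans tz (fsubset_leq_card sub).
    have tSy : (#|` S `\ y|).+1 = t by rewrite -tS [RHS](cardfsD1 y) yS.
    by rewrite -{1}tSy ltnn.
  case/fsubsetPn => u; rewrite !inE => /and3P[uh /eqP cuz wzu].
  rewrite negb_and negbK => /orP[/eqP uy|uS].
    by move: cuz; rewrite uy cy czx; case: (c x).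
  suff : w u <= w x by rewrite leqNgt -wzx wzu.
  by apply: (swap_le S) => //; apply: swap_crossing => //; rewrite cuz.
have [S0 [S0h tS0 cS0]] := crossing_subset t2h ch.
have [S HS] : exists S, heaviest S.
  have S0P : S0 \in fpowerset h by rewrite fpowersetE.
  have g0 : good (val [` S0P]) by rewrite /= /good S0h tS0 eqxx.
  have [S gS maxS] := @arg_maxnP (fpowerset h) [` S0P]
    (fun S => good (val S)) (fun S => weight (val S)) g0.
  exists (val S); split => // S' gS'.
  have S'P : S' \in fpowerset h by rewrite fpowersetE; case/and3P: gS'.
  exact: (maxS [` S'P]).
have [/and3P[Sh /eqP tS cS] maxS] := HS; exists S; split => //.
move=> S' S'h tS' cS' neqS eqw.
have HS' : heaviest S'.
  split; first by rewrite /good S'h tS' eqxx.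
  by move=> S1 gS1; rewrite /weight eqw; apply: maxS.
have [x xS xS'] : exists2 x, x \in S & x \notin S'.
  by apply/fsubsetPn; apply: contra neqS => sub; rewrite eq_sym eqEfcard sub tS tS' /=.
have [y yS' yS] : exists2 y, y \in S' & y \notin S.
  by apply/fsubsetPn; apply: contra neqS => sub; rewrite eqEfcard sub tS tS' leqnn.
have sides u v : u \in S -> u \notin S' -> v \in S' -> v \notin S -> c u != c v.
  move=> uS uS' vS' vS; apply/eqP => cuv.
  have lt_vu := side_lt S u v HS uS (fsubsetP S'h v vS') vS (esym cuv).
  have lt_uv := side_lt S' v u HS' vS' (fsubsetP Sh u uS) uS' cuv.
  by have := ltn_trans lt_vu lt_uv; rewrite ltnn.
have cxy := sides x y xS xS' yS' yS.
have xh := fsubsetP Sh x xS; have yh := fsubsetP S'h y yS'.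
have [/crossingP cSb /crossingP cS'b] := (cS, cS').
have le1 : w y <= w x.
  apply: (swap_le S) => //; apply/crossingP => b.
  have [cyb|cyb] := eqVneq (c y) b; first by exists y => //; rewrite in_fset1U eqxx.
  (* The side of [x] must keep a point: [u] belongs to [S], since otherwise [sides] would put it
     opposite [x]. *)
  have [u uS' cu] := cS'b b; exists u => //; rewrite !inE.
  have -> : u != x by apply: contraNneq xS' => <-.
  have [_|uS] := boolP (u \in S); first by rewrite orbT.
  have := sides x u xS xS' uS' uS; rewrite cu.
  by move: cxy cyb; case: (c x) (c y) b {cu} => [] [] [].
have le2 : w x <= w y.
  apply: (swap_le S') => //; apply/crossingP => b.
  have [cxb|cxb] := eqVneq (c x) b; first by exists x => //; rewrite in_fset1U eqxx.
  have [u uS cu] := cSb b; exists u => //; rewrite !inE.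
  have -> : u != y by apply: contraNneq yS => <-.
  have [_|uS'] := boolP (u \in S'); first by rewrite orbT.
  have := sides u y uS uS' yS' yS; rewrite cu.
  by move: cxy cxb; case: (c x) (c y) b {cu} => [] [] [].
have xy : x != y by apply: contra_neq cxy => ->.
have wxy : w x = w y by apply/eqP; rewrite eqn_leq le1 le2.
by have [cxy' _] := w_strong x y xh yh xy wxy; rewrite cxy' eqxx in cxy.
Qed.

End HeaviestSubset.

(** * Dyadic blocks and split heights *)

Section SplitHeight.
Local Open Scope fset_scope.
Local Open Scope nat_scope.
Variables (T : choiceType) (Y : T -> nat).

Definition same_block (j : nat) (S : {fset T}) : bool :=
  all2rel (fun p q => Y p %/ 2 ^ j == Y q %/ 2 ^ j) S.

Lemma same_blockP (j : nat) (S : {fset T}) :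
  reflect {in S &, forall p q, Y p %/ 2 ^ j = Y q %/ 2 ^ j} (same_block j S).
Proof.
apply: (iffP allrelP) => H p q pS qS; first exact/eqP/H.
by apply/eqP/H.
Qed.

Lemma same_block_le (i j : nat) (S : {fset T}) :
  i <= j -> same_block i S -> same_block j S.
Proof.
move=> ij /same_blockP iS; apply/same_blockP => p q pS qS.
by rewrite -(subnKC ij) expnD !divnMA (iS p q).
Qed.

(** A failed [find] returns [D], the right value when all ranks are below [2 ^ D]. *)
Definition split_height (D : nat) (S : {fset T}) : nat :=
  find (same_block^~ S) (iota 0 D).

Lemma split_height_le (D : nat) (S : {fset T}) : split_height D S <= D.
Proof. by rewrite -[leqRHS](size_iota 0 D) find_size. Qed.

Lemma same_block_split_height (D : nat) (S : {fset T}) :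
  {in S, forall p, Y p < 2 ^ D} -> same_block (split_height D S) S.
Proof.
move=> YD; have := split_height_le D S; rewrite leq_eqVlt => /orP[/eqP ->|lD].
  by apply/same_blockP => p q pS qS; rewrite !divn_small ?YD.
have hasl : has (same_block^~ S) (iota 0 D) by rewrite has_find size_iota.
by have := nth_find 0 hasl; rewrite nth_iota.
Qed.

(** Blocks are nested, so [same_block] is monotone in [j] and its change from false to true
    determines the height. *)
Lemma split_heightP (D j : nat) (S : {fset T}) :
  {in S, forall p, Y p < 2 ^ D} ->
  reflect (same_block j.+1 S /\ ~~ same_block j S) (split_height D S == j.+1).
Proof.
move=> YD; set l := split_height D S.
have block_l : same_block l S := same_block_split_height YD.
have before_l i : i < l -> ~~ same_block i S.
  move=> il; have := before_find 0 il.
  by rewrite nth_iota ?add0n ?(leq_trans il) ?split_height_le // => ->.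
apply: (iffP eqP) => [lj|[jS njS]].
  by split; [rewrite -lj|apply: before_l; rewrite lj].
apply/eqP; rewrite eqn_leq; apply/andP; split.
  by rewrite leqNgt; apply: contraL jS => /before_l.
by rewrite ltnNge; apply: contra njS => /same_block_le; apply.
Qed.

End SplitHeight.

(** * Colouring hypergraphs with box-convex hyperedges *)

Section BoxConvex.
Local Open Scope fset_scope.
Local Open Scope nat_scope.
Variables (T : choiceType) (X Y : T -> nat).

Definition box_convex (V h : {fset T}) : Prop :=
  forall z, z \in V ->
    (exists p q, [/\ p \in h, q \in h & X p <= X z <= X q]) ->
    (exists p q, [/\ p \in h, q \in h & Y p <= Y z <= Y q]) -> z \in h.

(** The first factor counts split heights, the second total weights: [t] summands, each at most
    [2N + 1], where [N] bounds the peeling rounds. *)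
Lemma box_convex_colouring (R : realType) (G : hypergraph T) (t D : nat) :
  2 <= t -> {in vertices G &, injective X} -> {in vertices G &, injective Y} ->
  {in vertices G, forall p, Y p < 2 ^ D} ->
  (forall h, hyperedges G h -> box_convex (vertices G) h) ->
  subset_CF_colourable G t (D.+1 *
    (t * (Num.truncn ((t.*2).+1%:R * ln (#|` vertices G|%:R) : R)%R).+1.*2)).
Proof.
move=> t2 X_inj Y_inj YD G_convex; set V := vertices G in X_inj Y_inj YD G_convex *.
set N := Num.truncn _.
pose g j p := Y p %/ 2 ^ j.
pose c j p := odd (g j p).
(* Within a block [K j] orders the points by distance to the line that
   separates the block from its sibling. *)
pose K j p := if c j p then Y p else 2 ^ D - Y p.
(* With the block index as class, one weight function serves all blocks of level [j] at once. *)
have [f fP] := choice (fun j => strong_colouring R (K j) (g j) t X_inj).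
have f_le j p : p \in V -> f j p <= N.
  move=> pV; have [fle _] := fP j; rewrite truncn_ge_nat ?fle //.
  by apply: le_trans (fle p pV); rewrite ler0n.
(* The parity of the weight records the side of the midline, so equal weights force equal sides. *)
pose w j p := (f j p).*2 + c j p.
pose l := split_height Y D.
pose M := t * N.+1.*2.
have w_lt j (S : {fset T}) : S `<=` V -> #|` S| = t -> \sum_(p <- S) w j p < M.
  move=> SV tS; apply: (@leq_ltn_trans (\sum_(p <- S) N.*2.+1)).
    rewrite big_seq [leqRHS]big_seq; apply: leq_sum => p pS.
    by have := f_le j p (fsubsetP SV p pS); rewrite /w; case: (c j p); lia.
  by rewrite big_const_seq count_predT iter_addn_0 tS /M; nia.
(* The pair of height and weight in base [M]. Height [j + 1] means a cut between blocks of level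
   [j], hence the predecessor. *)
pose phi S := l S * M + \sum_(p <- S) w (l S).-1 p.
exists phi; split=> [S SV tS|h hG th].
  rewrite mulSn addnC -/M /phi; have := w_lt (l S).-1 S SV tS.
  have : l S * M <= D * M by rewrite leq_mul2r split_height_le orbT.
  lia.
have hV : h `<=` V := hyperedges_sub hG.
have sub_lt (S : {fset T}) : S `<=` h -> {in S, forall p, Y p < 2 ^ D}.
  by move=> Sh p pS; apply/YD/(fsubsetP hV)/(fsubsetP Sh).
(* At height 0 all members of [h] share one rank, so [h] is a single point, which is too small. *)
have [j lh] : exists j, l h = j.+1.
  case lh: (l h) => [|j]; last by exists j.
  have := same_block_split_height (sub_lt h (fsubset_refl h)).
  rewrite -/(l h) lh => /same_blockP same_h.
  have [p ph] : exists p, p \in h by apply/fset0Pn; rewrite -cardfs_gt0; lia.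
  have : h `<=` [fset p].
    apply/fsubsetP => q qh; rewrite in_fset1; apply/eqP.
    have Yqp : Y q = Y p by have := same_h q p qh ph; rewrite !divn1.
    by apply: Y_inj => //; apply: (fsubsetP hV).
  by move=> /fsubset_leq_card; rewrite cardfs1 => h1; have := leq_trans th h1; lia.
have /eqP/(split_heightP _ (sub_lt h (fsubset_refl h)))[blockh splith] := lh.
(* [v] is the block of level [j + 1] containing [h]; its halves are the blocks [2v] and [2v + 1]. *)
have [v gh] : exists v, {in h, forall p, g j p = v.*2 + c j p}.
  have [p0 p0h] : exists p, p \in h by apply/fset0Pn; rewrite -cardfs_gt0; lia.
  exists (Y p0 %/ 2 ^ j.+1) => p ph; rewrite -(same_blockP _ _ _ blockh p p0 ph p0h).
  by rewrite expnSr divnMA divn2 addnC odd_double_half.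
have l_crossing (S : {fset T}) : S `<=` h -> (l S == j.+1) = crossing (c j) S.
  move=> Sh; have inh := fsubsetP Sh.
  apply/(split_heightP _ (sub_lt S Sh))/crossingP; last first.
    move=> cS; split.
      by apply/same_blockP => p q /inh ph /inh qh; apply: (same_blockP _ _ _ blockh).
    have [[p pS cp] [q qS cq]] := (cS true, cS false).
    apply/negP => /same_blockP/(_ p q pS qS); rewrite -!/(g j _).
    rewrite (gh p (inh p pS)) (gh q (inh q qS)) cp cq.
    by move=> /addnI.
  case=> _ /allPn[p pS /allPn[q qS]].
  rewrite -!/(g j _) (gh p (inh p pS)) (gh q (inh q qS)) eqn_add2l => cpq b; have [cpb|cpb] := eqVneq (c j p) b; first by exists p.
  by exists q => //; case: (c j p) (c j q) b cpq cpb => [] [] [].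
have ch : crossing (c j) h by rewrite -l_crossing ?fsubset_refl // lh.
have t2h : 2 <= t <= #|` h| by rewrite t2 ltnW.
have w_strong : {in h &, forall p q, p != q -> w j p = w j q ->
    c j p = c j q /\ t <= #|` [fset z in h | (c j z == c j p) && (w j p < w j z)]|}.
  move=> p q ph qh pq wpq.
  have cpq : c j p = c j q.
    by have := congr1 odd wpq; rewrite /w !oddD !odd_double !oddb.
  have fpq : f j p = f j q by move: wpq; rewrite /w cpq => /addIn/double_inj.
  have gpq : g j p = g j q by rewrite (gh p ph) (gh q qh) cpq.
  have [pV qV] := (fsubsetP hV p ph, fsubsetP hV q qh).
  have [_ /(_ p q pV qV pq gpq fpq) tle] := fP j; split => //.
  apply: leq_trans tle _; apply/fsubset_leq_card/fsubsetP => z; rewrite !inE.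
  case/andP=> /and5P[zV /eqP gz Xz1 Xz2 Kz] fz.
  have cz : c j z = c j p by rewrite /c gz.
  rewrite cz eqxx /= /w cz ltn_add2r ltn_double fz andbT.
  (* [K] bounds [z] only away from the midline; the point [u] across the midline bounds it on the
     other side. *)
  have /crossingP ch' := ch; have [u uh cu] := ch' (~~ c j p).
  have guz : g j u = v.*2 + ~~ c j p by rewrite (gh u uh) cu.
  have gzv : g j z = v.*2 + c j p by rewrite gz (gh p ph).
  have g_lt a b : g j a < g j b -> Y a <= Y b.
    move=> gab; rewrite leqNgt; apply/negP => /ltnW Yba.
    by move: gab; rewrite ltnNge leq_div2r.
  apply: (G_convex h hG z zV).
    have [Xpq|Xqp] := leqP (X p) (X q).
      by exists p, q; split => //; clear -Xpq Xz1 Xz2; lia.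
    by exists q, p; split => //; clear -Xqp Xz1 Xz2; lia.
  have [Yp Yq Yz] := And3 (YD p pV) (YD q qV) (YD z zV).
  move: Kz; rewrite /K cz -cpq.
  case cp: (c j p) guz gzv => /= guz gzv Kz.
    have Yuz : Y u <= Y z by apply: g_lt; rewrite guz gzv addn0 addn1.
    have [Ypq|Yqp] := leqP (Y p) (Y q).
      by exists u, q; split => //; clear -Yuz Ypq Kz; lia.
    by exists u, p; split => //; clear -Yuz Yqp Kz; lia.
  have Yzu : Y z <= Y u by apply: g_lt; rewrite guz gzv addn0 addn1.
  have [Ypq|Yqp] := leqP (Y p) (Y q).
    by exists p, u; split => //; clear -Yzu Ypq Kz Yz Yp Yq; lia.
  by exists q, u; split => //; clear -Yzu Yqp Kz Yz Yp Yq; lia.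
have [S [Sh tS cS S_unique]] := unique_heaviest t2h ch w_strong.
exists S; split => // S' S'h tS' /eqP S'S eq_phi.
have lS : l S = j.+1 by apply/eqP; rewrite l_crossing.
have M_gt0 : 0 < M by rewrite /M; nia.
(* Quotients by [M] recover the heights, so [S'] crosses the same midline and competes with [S] by
   weight alone. *)
have lS' : l S' = j.+1.
  rewrite -lS; have := congr1 (divn^~ M) eq_phi.
  by rewrite /phi !divnMDl // !divn_small ?addn0 // w_lt // (fsubset_trans _ hV).
apply: (S_unique S' S'h tS' _ S'S); first by rewrite -l_crossing // lS'.
by move: eq_phi; rewrite /phi lS lS' /= => /addnI.
Qed.

End BoxConvex.

(** * Ranks of coordinates and the number of colours *)

Local Open Scope ring_scope.

(** Positions in a sorted list break ties, so order passes from ranks to values only, the direction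
    that convexity needs. *)
Lemma exists_rank (T : choiceType) d (O : orderType d) (V : {fset T})
    (e : T -> O) :
  exists X : T -> nat, [/\ {in V &, injective X},
    {in V, forall p, (X p < #|` V|)%N} &
    {in V &, forall p q, (X p <= X q)%N -> (e p <= e q)%O}].
Proof.
pose le_e p q := (e p <= e q)%O.
pose s := sort le_e V.
have sV : s =i V by move=> p; rewrite mem_sort.
have s_sorted : sorted le_e s by apply: sort_sorted => p q; apply: le_total.
exists (index^~ s); split=> [p q pV qV||p q pV qV].
- by apply: (index_inj p); rewrite sV.
- by move=> p pV; rewrite -(size_sort le_e) index_mem sV.
apply: (sorted_leq_index _ _ s_sorted); rewrite ?sV //.
  by move=> y x z; apply: le_trans.
by move=> x; apply: lexx.
Qed.

Lemma chi_CF_le (T : choiceType) (G : hypergraph T) (t k : nat) :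
  subset_CF_colourable G t k -> (chi_CF G t <= k)%N.
Proof.
by move=> Gk; rewrite /chi_CF; case: ex_minnP => m _; apply; apply/asboolP.
Qed.

(** There is no [t]-subset to colour. This covers [n <= 1], outside the range of the logarithmic
    estimate. *)
Lemma chi_CF_small (T : choiceType) (G : hypergraph T) (t : nat) :
  (#|` vertices G| < t)%N -> chi_CF G t = 0%N.
Proof.
move=> Gt; apply/eqP; rewrite -leqn0; apply: chi_CF_le; exists (fun=> 0%N); split.
  by move=> s /fsubset_leq_card sV ts; move: sV; rewrite ts leqNgt Gt.
move=> h /hyperedges_sub/fsubset_leq_card hV th.
by have := leq_ltn_trans hV (ltn_trans Gt th); rewrite ltnn.
Qed.

(** It multiplies [D + 1 <= 3 L / a] and [N + 1 <= t L (3 + 1 / a)]; additive constants are absorbed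
    by [1 <= L / a], that is, [n >= 2]. *)
Lemma colour_count_le (R : realType) (t n : nat) : (2 <= t)%N -> (2 <= n)%N ->
  (((up_log 2 n).+1 *
    (t * (Num.truncn ((t.*2).+1%:R * ln (n%:R) : R)).+1.*2))%:R : R) <=
  6 / ln 2 * (3 + (ln 2)^-1) * t%:R ^+ 2 * ln (n%:R : R) ^+ 2.
Proof.
move=> t2 n2; set D := up_log 2 n; set N := Num.truncn _.
set L := ln (n%:R : R); set a := ln (2 : R).
have a_gt0 : 0 < a by rewrite ln_gt0 // ltr1n.
have aL : a <= L by rewrite ler_ln ?posrE ?ltr0n ?ler_nat //; apply: ltnW.
have L_gt0 : 0 < L by apply: lt_le_trans aL.
have La : 1 <= L / a by rewrite ler_pdivlMr // mul1r.
have tR : 2 <= t%:R :> R by rewrite ler_nat.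
have D_le : D.+1%:R <= 3 * (L / a).
  have D_gt0 : (0 < D)%N by rewrite up_log_gt0.
  have : D.-1%:R * a <= L.
    rewrite mulr_natl -lnXn // ler_ln ?posrE ?exprn_gt0 ?ltr0n //; last by lia.
    by rewrite -natrX ler_nat ltnW // up_log_gtn.
  rewrite -ler_pdivlMr // => D1.
  have -> : D.+1%:R = D.-1%:R + 2 :> R by rewrite -natrD; congr _%:R; lia.
  by lra.
have N_le : N.+1%:R <= t%:R * L * (3 + a^-1).
  have : N%:R <= (t.*2).+1%:R * L by rewrite truncn_le mulr_ge0 ?ler0n // ltW.
  have -> : (t.*2).+1%:R = 2 * t%:R + 1 :> R by rewrite -natr1 -mul2n natrM.
  rewrite -natr1 mulrDr -[t%:R * L / a]mulrA.
  by nra.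
rewrite -muln2 !natrM.
have -> : 6 / a * (3 + a^-1) * t%:R ^+ 2 * L ^+ 2 =
  3 * (L / a) * (t%:R * (t%:R * L * (3 + a^-1) * 2)).
  by field; rewrite gt_eqF.
by rewrite ler_pM // ?ler_wpM2l ?ler_wpM2r ?mulr_ge0 ?ler0n.
Qed.

(** * Rectangles as box-convex hyperedges *)

Lemma rectangle_convex (R : realType) (r : set (R * R)) (p q p' q' z : R * R) :
  axis_parallel_rectangle r -> r p -> r q -> r p' -> r q' ->
  p.1 <= z.1 <= q.1 -> p'.2 <= z.2 <= q'.2 -> r z.
Proof.
case=> [a [b [c [d [wa [wb [wc [wd [_ _ ->]]]]]]]]].
move=> [p1 _] [q1 _] [_ p2] [_ q2] z1 z2; split.
  exact: (interval_is_interval p1 q1).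
exact: (interval_is_interval p2 q2).
Qed.

Theorem theorem1p8 (R : realType) :
  exists2 K : R, 0 < K &
    forall (t n : nat) (P : {fset R * R}) (Rs : set (set (R * R))),
      (2 <= t)%N -> #|` P| = n ->
      (forall r, Rs r -> axis_parallel_rectangle r) ->
      (chi_CF (intersection_hypergraph (point_singletons P) Rs) t)%:R
        <= K * t%:R ^+ 2 * ln (n%:R : R) ^+ 2.
Proof.
have ln2_gt0 : 0 < ln (2 : R) by rewrite ln_gt0 // ltr1n.
have K_gt0 : 0 < 6 / ln 2 * (3 + (ln 2)^-1) :> R.
  by rewrite mulr_gt0 ?divr_gt0 // addr_gt0 // invr_gt0.
exists (6 / ln 2 * (3 + (ln 2)^-1)) => // t n P Rs t2 Pn Rs_rect.
set G := intersection_hypergraph _ _.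
have Vn : #|` vertices G| = n.
  rewrite -Pn; apply: card_imfset => p q pq.
  by have : [set p]%classic p by []; rewrite pq.
have [ltnt|lent] := ltnP n t.
  rewrite chi_CF_small ?Vn // mulr_ge0 ?sqr_ge0 // mulr_ge0 ?sqr_ge0 //.
  exact: ltW.
apply: le_trans (colour_count_le R t2 (leq_trans t2 lent)).
(* Vertices are singletons and [u] recovers the point; the default concerns the empty set, which is
   no vertex. *)
pose u (b : set (R * R)) : R * R := xget (0, 0) b.
have u1 p : u [set p]%classic = p by apply: xget_subset1 => // x y -> ->.
have [X [X_inj _ X_le]] := exists_rank (vertices G) (fun b => (u b).1).
have [Y [Y_inj Y_lt Y_le]] := exists_rank (vertices G) (fun b => (u b).2).
rewrite ler_nat -Vn; apply: chi_CF_le.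
apply: (@box_convex_colouring _ X Y) => //.
  by move=> p /Y_lt Yp; apply: leq_trans Yp _; apply: up_logP.
move=> h [r rRs <-] z zV.
have memP b : b \in meeting_members (point_singletons P) r ->
    b \in vertices G /\ r (u b).
  rewrite !inE => /andP[bV /asboolP br]; split => //.
  by have /imfsetP[/= p _ bp] := bV; move: br; rewrite bp u1 => -[x [->]].
case=> p [q [/memP[pV rp] /memP[qV rq] /andP[Xpz Xzq]]].
case=> p' [q' [/memP[pV' rp'] /memP[qV' rq'] /andP[Ypz Yzq]]].
rewrite !inE; have -> /= : z \in point_singletons P by [].
apply/asboolP; exists (u z).
have /imfsetP[/= x _ zx] := zV; split; first by rewrite zx u1.
apply: (rectangle_convex (Rs_rect r rRs) rp rq rp' rq').
  by rewrite !X_le.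
by rewrite !Y_le.
Qed.
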